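(* Let $n\ge 8$. There is no retraction of $\mathrm{SL}_n\mathbb{C}$ to $\mathrm{SU}_n$ preserving commutativity. That is, there is no continuous map $$\phi:[0,1]\times \mathrm{SL}_n\mathbb{C}\to \mathrm{SL}_n\mathbb{C},\qquad (t,A)\mapsto\phi_t(A),$$ such that both of the following hold: (i) for all $A,B\in \mathrm{SL}_n\mathbb{C}$ with $AB=BA$ and all $t\in[0,1]$ one has $\phi_t(A)\phi_t(B)=\phi_t(B)\phi_t(A)$; (ii) $\phi_0(A)=A$ and $\phi_1(A)\in \mathrm{SU}_n$ for all $A\in \mathrm{SL}_n\mathbb{C}$.
   Context: $\mathrm{SU}_n\subset \mathrm{SL}_n\mathbb{C}$ is the special unitary group of the standard hermitian form on $\mathbb{C}^n$. All groups carry their usual (Lie group) topology. *)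

(* Defs.v *)
From HB Require Import structures.
From mathcomp Require Import all_boot all_order all_algebra.
From mathcomp Require Import complex.
From mathcomp Require Import boolp classical_sets set_interval reals.
From mathcomp Require Import topology normedtype.

Set Implicit Arguments.
Unset Strict Implicit.
Unset Printing Implicit Defensive.

Import Order.TTheory GRing.Theory Num.Theory.
Import numFieldNormedType.Exports.

Local Open Scope classical_set_scope.
Local Open Scope ring_scope.

(* [R[i]] bundled as a [numClosedFieldType]: MathComp-Analysis provides the
   norm topology (hence the product topology on matrices) on the carrier of
   such a structure, but not on the bare type [complex R]. *)
Definition Cplx (R : realType) : numClosedFieldType := R[i].

Definition SL (R : realType) (n : nat) : set 'M[Cplx R]_n :=
  [set A | \det A = 1].

Definition SU (R : realType) (n : nat) : set 'M[Cplx R]_n :=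
  [set A | A \is unitarymx /\ \det A = 1].

Arguments SL R n A : clear implicits.
Arguments SU R n A : clear implicits.

(* Main.v *)
(** An idempotent [e = g E_ii g^-1] of rank one gives a loop
    [s |-> z^((n-1)s) e + z^(-s) (1 - e)], [z = exp (2 pi i)], in the torus
    [g T g^-1].  Each [phi_t] maps it to a loop of commuting matrices, and the
    product of the [2^j]-th roots of the increments along a fine subdivision is
    a matrix [R_t] with [R_t ^ (2^j) = 1] which is continuous in [t]; at [t = 0]
    it has [e] as a spectral projection.  Following this projection from
    [t = 0] to [t = 1] defines [f e] such that the [f (g E_ii g^-1)] are, for
    each [g], orthogonal idempotents of sum [1], bounded independently of [g]
    because [R_1] is unitary.  Such an [f] cannot exist: for [n >= 3],
    transvections show that [f (g (E_bb + s E_ab) g^-1)] is affine in [s], hence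
    constant, hence all the [f E_ii] are equal. *)

Require Import Defs.
From HB Require Import structures.
From mathcomp Require Import all_boot all_order all_algebra.
From mathcomp Require Import complex.
From mathcomp Require Import boolp classical_sets set_interval reals.
From mathcomp Require Import topology normedtype.
From mathcomp Require Import interval_inference sequences trigo.
From mathcomp Require Import lra.

Set Implicit Arguments.
Unset Strict Implicit.
Unset Printing Implicit Defensive.

Import Order.TTheory GRing.Theory Num.Theory.
Import numFieldNormedType.Exports.

Local Open Scope classical_set_scope.
Local Open Scope ring_scope.

(** * The real-valued modulus of a complex number *)

Section ComplexAbs.
Variable R : realType.
Implicit Types x y : Cplx R.

(** The norm of [Cplx R] takes its values in [Cplx R]; taking the real part moves estimates to [R],
    where [lra] applies. *)
Definition cabs x : R := complex.Re `|x|.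

Lemma cabsE x : (cabs x)%:C%C = `|x|.
Proof. exact: RRe_real (normr_real x). Qed.

Lemma cabs_ge0 x : 0 <= cabs x.
Proof. by rewrite -lecR cabsE; exact: normr_ge0. Qed.

Lemma cabs0 : cabs 0 = 0.
Proof. by rewrite /cabs normr0. Qed.

Lemma cabs1 : cabs 1 = 1.
Proof. by rewrite /cabs normr1. Qed.

Lemma cabs_eq0 x : cabs x = 0 -> x = 0.
Proof. by move=> x0; apply/normr0_eq0; rewrite -cabsE x0. Qed.

Lemma cabsD x y : cabs (x + y) <= cabs x + cabs y.
Proof.
rewrite -lecR cabsE raddfD; apply: le_trans (ler_normD _ _) _.
by rewrite -!cabsE.
Qed.


Lemma cabsN x : cabs (- x) = cabs x.
Proof. by rewrite /cabs normrN. Qed.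

Lemma cabsM x y : cabs (x * y) = cabs x * cabs y.
Proof. by apply: (@complexI R); rewrite rmorphM /= !cabsE normrM. Qed.

Lemma cabs_conj x : cabs x^* = cabs x.
Proof. by rewrite /cabs norm_conjC. Qed.

Lemma cabs_sum (I : finType) (F : I -> Cplx R) :
  cabs (\sum_i F i) <= \sum_i cabs (F i).
Proof.
elim/big_ind2: _ => [|x1 x2 y1 y2 h1 h2|//]; first by rewrite cabs0.
by rewrite (le_trans (cabsD _ _)) // lerD.
Qed.

Lemma Re_le_cabs x : `|complex.Re x| <= cabs x.
Proof. by rewrite -lecR cabsE normc_ge_Re. Qed.

Lemma cabs_i : cabs 'i%C = 1.
Proof. by rewrite /cabs normc_def /= expr0n add0r expr1n sqrtr1. Qed.

Lemma cabs_real (r : R) : cabs r%:C%C = `|r|.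
Proof. by rewrite /cabs normc_def /= expr0n addr0 sqrtr_sqr. Qed.

Lemma Im_le_cabs x : `|complex.Im x| <= cabs x.
Proof. by rewrite -normrN -ReiNIm (le_trans (Re_le_cabs _)) // cabsM cabs_i mulr1. Qed.

Lemma cabs_le x : cabs x <= `|complex.Re x| + `|complex.Im x|.
Proof.
rewrite {1}[x]complexE; apply: le_trans (cabsD _ _) _.
by rewrite cabsM !cabs_real cabs_i mul1r.
Qed.

End ComplexAbs.

(** * A submultiplicative norm on matrices *)

Section MatrixNorm.
Variables (R : realType) (n : nat).
Local Notation M := 'M[Cplx R]_n.+1.
Implicit Types X Y : M.

(** The entrywise [l^1] norm: submultiplicative and invariant under the adjoint, although [1] has
    norm [n + 1]. *)
Definition nrm X : R := \sum_i \sum_j cabs (X i j).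

Lemma nrm_ge0 X : 0 <= nrm X.
Proof. by do 2!apply: sumr_ge0 => ? _; apply: cabs_ge0. Qed.

Lemma cabs_le_nrm X i j : cabs (X i j) <= nrm X.
Proof.
rewrite /nrm (bigD1 i) //= (bigD1 j) //= -addrA lerDl addr_ge0 //.
  by apply: sumr_ge0 => ? _; apply: cabs_ge0.
by do 2!apply: sumr_ge0 => ? _; apply: cabs_ge0.
Qed.

Lemma nrm_eq0 X : nrm X = 0 -> X = 0.
Proof.
move=> X0; apply/matrixP => i j; rewrite mxE; apply: cabs_eq0.
by apply/eqP; rewrite eq_le cabs_ge0 andbT -X0 cabs_le_nrm.
Qed.

Lemma nrm0 : nrm 0 = 0.
Proof. by rewrite /nrm big1 // => i _; rewrite big1 // => j _; rewrite mxE cabs0. Qed.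

Lemma nrmD X Y : nrm (X + Y) <= nrm X + nrm Y.
Proof.
rewrite /nrm -big_split ler_sum // => i _; rewrite -big_split ler_sum //= => j _.
by rewrite mxE cabsD.
Qed.

Lemma nrmN X : nrm (- X) = nrm X.
Proof. by rewrite /nrm; do 2!apply: eq_bigr => ? _; rewrite mxE cabsN. Qed.

Lemma nrm_distC X Y : nrm (X - Y) = nrm (Y - X).
Proof. by rewrite -nrmN opprB. Qed.

Lemma nrmZ a X : nrm (a *: X) = cabs a * nrm X.
Proof.
rewrite /nrm mulr_sumr; apply: eq_bigr => i _.
by rewrite mulr_sumr; apply: eq_bigr => j _; rewrite mxE cabsM.
Qed.

Lemma nrm_sum (I : finType) (F : I -> M) : nrm (\sum_i F i) <= \sum_i nrm (F i).
Proof.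
elim/big_ind2: _ => [|x1 x2 y1 y2 h1 h2|//]; first by rewrite nrm0.
by rewrite (le_trans (nrmD _ _)) // lerD.
Qed.

Lemma nrmM X Y : nrm (X * Y) <= nrm X * nrm Y.
Proof.
rewrite /nrm mulr_suml ler_sum // => i _.
apply: (@le_trans _ _ (\sum_j \sum_k cabs (X i k) * cabs (Y k j))).
  apply: ler_sum => j _; rewrite -mulmxE mxE (le_trans (cabs_sum _)) //.
  by apply: ler_sum => k _; rewrite cabsM.
rewrite exchange_big /= mulr_suml ler_sum // => k _.
rewrite -mulr_sumr ler_wpM2l ?cabs_ge0 // [leRHS](bigD1 k) //= lerDl.
by do 2!apply: sumr_ge0 => ? _; apply: cabs_ge0.
Qed.

Lemma nrm_adjmx X : nrm (X^t*)%sesqui = nrm X.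
Proof.
rewrite /nrm exchange_big /=; do 2!apply: eq_bigr => ? _.
by rewrite !mxE cabs_conj.
Qed.

Lemma nrm_le_bound X (c : R) : (forall i j, cabs (X i j) <= c) ->
  nrm X <= c *+ (n.+1 * n.+1).
Proof.
move=> Xc; apply: (@le_trans _ _ (\sum_(i < n.+1) \sum_(j < n.+1) c)).
  by do 2!apply: ler_sum => ? _.
by rewrite !sumr_const card_ord -mulrnA.
Qed.

End MatrixNorm.

(** * Limits with geometric rate of convergence *)

Section Halving.
Variable R : realType.

(** If [x] were positive, [2 ^ k] would outgrow [c / x]. Later passages to the limit reduce to this
    bound. *)
Lemma le0_halving (x c : R) : (forall k, x <= c * 2^-1 ^+ k) -> x <= 0.
Proof.
move=> h; rewrite leNgt; apply/negP => x0.
have c0 : 0 <= c by rewrite (le_trans (ltW x0)) // (le_trans (h 0%N)) // expr0 mulr1.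
have := archi_boundP (divr_ge0 c0 (ltW x0)); set k := Num.bound _ => ck.
have k2 : k%:R <= 2 ^+ k :> R by rewrite -natrX ler_nat ltnW // ltn_expl.
have := h k; rewrite exprVn ler_pdivlMr ?exprn_gt0 // => xk.
have : c < x * 2 ^+ k by rewrite mulrC -ltr_pdivrMr // (lt_le_trans ck).
by move=> /lt_le_trans /(_ xk); rewrite ltxx.
Qed.

Lemma le_halving (x y c : R) : (forall k, x <= y + c * 2^-1 ^+ k) -> x <= y.
Proof.
move=> h; rewrite -subr_le0; apply: (@le0_halving _ c) => k.
by rewrite lerBlDl.
Qed.

(** The intervals with centre [u k] and radius [c k] meet pairwise, so the supremum of their left
    ends lies in all of them. *)
Lemma nested_limit (u c : nat -> R) :
  (forall k p, u k - c k <= u p + c p) -> exists l, forall k, `|u k - l| <= c k.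
Proof.
move=> h; pose A := range (fun k => u k - c k).
have A0 : A !=set0 by exists (u 0%N - c 0%N), 0%N.
have Aub p : ubound A (u p + c p) by move=> _ [k _ <-].
exists (sup A) => k; rewrite ler_distlC; apply/andP; split.
  by apply: ub_le_sup; [exists (u 0%N + c 0%N) | exists k].
exact: ge_sup.
Qed.

Lemma halving_limit (u : nat -> R) :
  (forall k, `|u k.+1 - u k| <= 2^-1 ^+ k) ->
  exists l, forall k, `|u k - l| <= 2 * 2^-1 ^+ k.
Proof.
move=> h.
(* The right-hand side is the geometric sum of [2^-i] for [i] from [k] to [k + d - 1]. *)
have hp k d : `|u (k + d)%N - u k| <= 2 * 2^-1 ^+ k - 2 * 2^-1 ^+ (k + d)%N.
  elim: d => [|d IH]; first by rewrite addn0 !subrr normr0.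
  rewrite addnS (le_trans (ler_distD (u (k + d)%N) _ _)) //.
  have := lerD (h (k + d)%N) IH; move/le_trans; apply.
  by rewrite exprS; lra.
have g0 k : 0 <= 2 * 2^-1 ^+ k :> R by rewrite mulr_ge0 // exprn_ge0 // invr_ge0.
apply: nested_limit => k p.
have [kp|/ltnW pk] := leqP k p.
  have := hp k (p - k)%N; rewrite subnKC // ler_norml => /andP[h1 _].
  by have := g0 k; have := g0 p; lra.
have := hp p (k - p)%N; rewrite subnKC // ler_norml => /andP[_ h1].
by have := g0 k; have := g0 p; lra.
Qed.

End Halving.

(** * Existence of square roots near the identity *)

Section SquareRoot.
Variables (R : realType) (n : nat).
Local Notation M := 'M[Cplx R]_n.+1.
Implicit Types X Y C E H : M.

(** With radius [1/8] the map [H |-> (E - H ^ 2) / 2] preserves the ball of that radius, as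
    [(1/8 + 1/64) / 2 < 1/8], and contracts it. *)
Definition near1 X := nrm (X - 1) <= 8^-1.

(* Writing [X = 1 + E] and [Y = 1 + H], the equation [Y ^ 2 = X] is the fixed
   point equation [H = (E - H ^ 2) / 2] of a contraction. *)
Fixpoint sqrt_iter E k : M :=
  if k is k'.+1 then 2^-1 *: (E - sqrt_iter E k' * sqrt_iter E k') else 0.

Lemma cabs_half : cabs (2^-1 : Cplx R) = 2^-1.
Proof.
rewrite (_ : 2^-1 = (2^-1 : R)%:C%C) ?cabs_real ?ger0_norm ?invr_ge0 ?ler0n //.
by rewrite fmorphV rmorph_nat.
Qed.

Lemma sqrt_iter_bound E k : nrm E <= 8^-1 -> nrm (sqrt_iter E k) <= 8^-1.
Proof.
move=> hE; elim: k => [|k IH] /=; first by rewrite nrm0; lra.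
rewrite nrmZ cabs_half; have := nrmD E (- (sqrt_iter E k * sqrt_iter E k)).
rewrite nrmN; have := nrmM (sqrt_iter E k) (sqrt_iter E k).
have := ler_pM (nrm_ge0 _) (nrm_ge0 _) IH IH; lra.
Qed.

Lemma nrm_sqrB H H' (c : R) : nrm H <= c -> nrm H' <= c ->
  nrm (H * H - H' * H') <= 2 * c * nrm (H - H').
Proof.
move=> h h'; have -> : H * H - H' * H' = H * (H - H') + (H - H') * H'.
  by rewrite mulrBr mulrBl addrA subrK.
have := nrmD (H * (H - H')) ((H - H') * H').
have := nrmM H (H - H'); have := nrmM (H - H') H'.
have := ler_wpM2r (nrm_ge0 (H - H')) h.
have := ler_wpM2l (nrm_ge0 (H - H')) h'; lra.
Qed.

(** On the ball of radius [1/8] squaring shrinks distances by a factor [1/4], so each iteration at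
    least halves the step. *)
Lemma sqrt_iter_step E k : nrm E <= 8^-1 ->
  nrm (sqrt_iter E k.+1 - sqrt_iter E k) <= 2^-1 ^+ k.
Proof.
move=> hE; elim: k => [|k IH].
  by rewrite expr0 subr0; have := sqrt_iter_bound 1 hE; lra.
set H := sqrt_iter E k in IH *; set H' := sqrt_iter E k.+1 in IH *.
have -> : sqrt_iter E k.+2 - H' = 2^-1 *: (H * H - H' * H').
  rewrite -[LHS]/(2^-1 *: (E - H' * H') - 2^-1 *: (E - H * H)) -scalerBr; congr (_ *: _).
  by rewrite addrC opprB addrA subrK.
rewrite nrmZ cabs_half exprS ler_wpM2l ?invr_ge0 // (le_trans _ IH) //.
have := nrm_sqrB (sqrt_iter_bound k hE) (sqrt_iter_bound k.+1 hE).
rewrite -/H -/H' (nrm_distC H' H) => /le_trans; apply.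
by have := nrm_ge0 (H - H'); lra.
Qed.

Lemma sqrt_iter_comm E C k : C * E = E * C -> C * sqrt_iter E k = sqrt_iter E k * C.
Proof.
move=> CE; elim: k => [|k IH] /=; first by rewrite mulr0 mul0r.
by rewrite -scalerAr -scalerAl mulrBr mulrBl CE -[in RHS]mulrA -IH !mulrA IH.
Qed.

(** Completeness of [R] is applied to the real and imaginary parts of each entry. *)
Lemma sqrt_iter_limit E : nrm E <= 8^-1 ->
  exists H, exists c : R, forall k, nrm (sqrt_iter E k - H) <= c * 2^-1 ^+ k.
Proof.
move=> hE.
have hre i j : exists l, forall k,
    `|complex.Re (sqrt_iter E k i j) - l| <= 2 * 2^-1 ^+ k.
  apply: halving_limit => k; apply: le_trans (sqrt_iter_step k hE).
  apply: le_trans (cabs_le_nrm _ i j); rewrite [X in cabs X]mxE [X in cabs (_ + X)]mxE.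
  by rewrite -raddfB; apply: Re_le_cabs.
have him i j : exists l, forall k,
    `|complex.Im (sqrt_iter E k i j) - l| <= 2 * 2^-1 ^+ k.
  apply: halving_limit => k; apply: le_trans (sqrt_iter_step k hE).
  apply: le_trans (cabs_le_nrm _ i j); rewrite [X in cabs X]mxE [X in cabs (_ + X)]mxE.
  by rewrite -raddfB; apply: Im_le_cabs.
pose H : M := \matrix_(i, j) (Complex (projT1 (cid (hre i j))) (projT1 (cid (him i j)))).
exists H, (4 *+ (n.+1 * n.+1)) => k; rewrite mulrnAl; apply: nrm_le_bound => i j.
apply: le_trans (cabs_le _) _; rewrite !mxE !raddfB /=.
have := projT2 (cid (hre i j)) k; have := projT2 (cid (him i j)) k; lra.
Qed.

(** The errors of the iterates decay like [2^-k], so the limit inherits their bound, the fixed point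
    equation, and commutation with everything that commutes with [X]. *)
Lemma sqrt_exists X : near1 X ->
  exists Y, [/\ Y * Y = X, near1 Y & forall C, C * X = X * C -> C * Y = Y * C].
Proof.
rewrite /near1; set E := X - 1 => hE; have [H [c hH]] := sqrt_iter_limit hE.
have Hb : nrm H <= 8^-1.
  apply: (@le_halving _ _ _ c) => k.
  have := nrmD (sqrt_iter E k) (H - sqrt_iter E k); rewrite addrC subrK.
  by rewrite nrm_distC; have := hH k; have := sqrt_iter_bound k hE; lra.
have HE : H + H = E - H * H.
  apply/eqP; rewrite -subr_eq0; apply/eqP/nrm_eq0/eqP; rewrite eq_le nrm_ge0 andbT.
  apply: (@le0_halving _ _ (4 * c)) => k.
  set S := sqrt_iter E k; set S' := sqrt_iter E k.+1.
  have S2 : S' + S' = E - S * S by rewrite /S' /= -mulr2n -scaler_nat scalerA divff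
    ?scale1r ?pnatr_eq0.
  have -> : H + H - (E - H * H) = (H - S') + (H - S') - (S * S - H * H).
    by rewrite [X in _ = X - _]addrACA -opprD S2 -[RHS]addrA -opprD addrA subrK.
  have h1 := hH k; have h2 := hH k.+1; rewrite exprS -/S' in h2; rewrite -/S in h1.
  have := nrmD (H - S' + (H - S')) (- (S * S - H * H)); rewrite nrmN.
  have := nrmD (H - S') (H - S'); rewrite nrm_distC.
  have := nrm_sqrB (sqrt_iter_bound k hE) Hb; rewrite -/S.
  by have := nrm_ge0 (S - H); lra.
exists (1 + H); split.
- rewrite mulrDl !mulrDr !mul1r mulr1 addrA -(addrA 1) HE -addrA subrK.
  by rewrite addrC subrK.
- by rewrite /near1 addrC addKr.
move=> C CX; rewrite mulrDl mulrDr mul1r mulr1; congr (_ + _).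
have CE : C * E = E * C by rewrite mulrBl mulrBr CX mul1r mulr1.
apply/eqP; rewrite -subr_eq0; apply/eqP/nrm_eq0/eqP; rewrite eq_le nrm_ge0 andbT.
apply: (@le0_halving _ _ (2 * nrm C * c)) => k.
have -> : C * H - H * C = C * (H - sqrt_iter E k) - (H - sqrt_iter E k) * C.
  by rewrite mulrBr mulrBl (sqrt_iter_comm _ CE) opprB addrA subrK.
have := nrmD (C * (H - sqrt_iter E k)) (- ((H - sqrt_iter E k) * C)); rewrite nrmN.
have := nrmM C (H - sqrt_iter E k); have := nrmM (H - sqrt_iter E k) C.
have := ler_wpM2l (nrm_ge0 C) (hH k); rewrite (nrm_distC H); lra.
Qed.

End SquareRoot.

(** * Unique square roots near the identity *)

Section Root.
Variables (R : realType) (n : nat).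
Local Notation M := 'M[Cplx R]_n.+1.
Implicit Types X Y C : M.
Local Open Scope sesquilinear_scope.

(** For [D = Y - Y'], commutation gives [D * (Y + Y') = 0], while [Y + Y'] is at distance less than
    [1] from [2]; hence [2 |D| <= |D|]. *)
Lemma sqrt_unique Y Y' : GRing.comm Y Y' ->
  nrm (Y - 1) <= 2^-1 -> nrm (Y' - 1) < 2^-1 -> Y * Y = Y' * Y' -> Y = Y'.
Proof.
move=> cY hY hY' e; pose D := Y - Y'.
have e2 : 2 *: D = - (D * (Y - 1) + D * (Y' - 1)).
  have D0 : D * (Y + Y') = 0.
    by rewrite mulrDr !mulrBl e -cY addrA subrK subrr.
  rewrite -mulrDr addrACA mulrDr D0 add0r -opprD mulrN opprK.
  by rewrite mulrDr mulr1 scaler_nat mulr2n.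
have h2 : 2 * nrm D = nrm (2 *: D).
  by rewrite nrmZ (_ : 2 = (2 : R)%:C%C) ?cabs_real ?ger0_norm ?rmorph_nat.
rewrite e2 nrmN in h2; have := nrmD (D * (Y - 1)) (D * (Y' - 1)).
have := nrmM D (Y - 1); have := nrmM D (Y' - 1).
have := ler_wpM2l (nrm_ge0 D) hY.
have [D0|D0] := leP (nrm D) 0.
  by move=> *; apply/eqP; rewrite -subr_eq0; apply/eqP/nrm_eq0/eqP; rewrite eq_le D0 nrm_ge0.
have : nrm D * nrm (Y' - 1) < nrm D * 2^-1 by rewrite ltr_pM2l.
by move=> *; exfalso; lra.
Qed.

(** The commutation clause makes roots of commuting matrices commute, and lets this root be compared
    with any other root near [1]. *)
Definition rt X := xget 1 [set Y | [/\ Y * Y = X, near1 Y &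
  forall C, GRing.comm C X -> GRing.comm C Y]].

Lemma rtP X : near1 X -> [/\ rt X * rt X = X, near1 (rt X) &
  forall C, GRing.comm C X -> GRing.comm C (rt X)].
Proof. by move=> /sqrt_exists; apply: xgetPex. Qed.

Lemma rt_unique X Y : near1 X -> near1 Y -> Y * Y = X -> rt X = Y.
Proof.
move=> X1 Y1 YX; have [rX r1 rc] := rtP X1.
apply: sqrt_unique; last by rewrite rX YX.
- by apply/commr_sym/rc; rewrite /GRing.comm -YX mulrA.
- by move: r1; rewrite /near1; lra.
- by move: Y1; rewrite /near1; lra.
Qed.

(** For [D = Y - Y'] the identity [X - X' = Y * D + D * Y'] holds even for non-commuting roots, and
    its right side is within [|D| / 4] of [2 D]. *)
Lemma rt_lip X X' : near1 X -> near1 X' -> nrm (rt X - rt X') <= nrm (X - X').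
Proof.
move=> /rtP[rX r1 _] /rtP[rX' r1' _]; set Y := rt X in rX r1 *; set Y' := rt X' in rX' r1' *.
have e : 2 *: (Y - Y') = X - X' - ((Y - 1) * (Y - Y') + (Y - Y') * (Y' - 1)).
  set D := Y - Y'; have -> : X - X' = Y * D + D * Y'.
    by rewrite -rX -rX' mulrBr mulrBl addrA subrK.
  rewrite (mulrBl D) (mulrBr D) mul1r mulr1 addrACA opprD addrA subrr add0r opprD !opprK.
  by rewrite scaler_nat mulr2n.
have h2 : 2 * nrm (Y - Y') = nrm (2 *: (Y - Y')).
  by rewrite nrmZ (_ : 2 = (2 : R)%:C%C) ?cabs_real ?ger0_norm ?rmorph_nat.
rewrite e in h2; have := nrmD (X - X') (- ((Y - 1) * (Y - Y') + (Y - Y') * (Y' - 1))).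
rewrite nrmN; have := nrmD ((Y - 1) * (Y - Y')) ((Y - Y') * (Y' - 1)).
have := nrmM (Y - 1) (Y - Y'); have := nrmM (Y - Y') (Y' - 1).
have := ler_wpM2l (nrm_ge0 (Y - Y')) r1'; have := ler_wpM2r (nrm_ge0 (Y - Y')) r1.
have := nrm_ge0 (Y - Y'); lra.
Qed.

(** The product of the root with its adjoint is near [1] and squares to [1], so it is [1] by
    uniqueness; computing its square uses that the root is normal. *)
Lemma rt_unitary X : near1 X -> X \is unitarymx -> rt X \is unitarymx.
Proof.
move=> X1 Xu; have [rX r1 rc] := rtP X1; set Y := rt X in rX r1 rc *.
have dM (A B : M) : (A * B)^t* = B^t* * A^t* by rewrite -!mulmxE trmx_mul map_mxM.
have XX : X * X^t* = 1 by apply/unitarymxP.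
have XX' : X^t* * X = 1 by rewrite -mulmxE; apply: mulmx1C.
(* The adjoint of [X] is its inverse, so it commutes with [Y]. Taking adjoints, the adjoint of [Y]
   commutes with [X], hence with [Y]. *)
have cYX : GRing.comm (X^t*) Y by apply: rc; rewrite /GRing.comm XX XX'.
have cYY : GRing.comm Y (Y^t*).
  apply/commr_sym/rc; have /(congr1 (fun Z : M => Z^t*)) := cYX.
  by rewrite !dM trmxCK.
have dY1 : near1 (Y^t*).
  rewrite /near1 (_ : _ - 1 = (Y - 1)^t*) ?nrm_adjmx //.
  by rewrite raddfB /= map_mxB trmx1 map_mx1.
apply/unitarymxP; rewrite mulmxE; apply: sqrt_unique.
- exact: commr1.
- rewrite (_ : _ - 1 = (Y - 1) * (Y^t* - 1) + (Y - 1) + (Y^t* - 1)); last first.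
    by rewrite mulrBr mulr1 subrK mulrBl mul1r addrA subrK.
  have := nrmD ((Y - 1) * (Y^t* - 1) + (Y - 1)) (Y^t* - 1).
  have := nrmD ((Y - 1) * (Y^t* - 1)) (Y - 1).
  have := nrmM (Y - 1) (Y^t* - 1); have := ler_pM (nrm_ge0 _) (nrm_ge0 _) r1 dY1.
  by move: r1 dY1; rewrite /near1; lra.
- by rewrite subrr nrm0 invr_gt0.
by rewrite mulr1 mulrA -(mulrA Y) -cYY mulrA rX -mulrA -dM rX XX.
Qed.

Definition rtn j X := iter j rt X.

Lemma rtnP j X : near1 X -> [/\ rtn j X ^+ (2 ^ j)%N = X, near1 (rtn j X) &
  forall C, GRing.comm C X -> GRing.comm C (rtn j X)].
Proof.
move=> X1; elim: j => [|j [h1 h2 h3]] /=; first by rewrite expr1.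
have [r1 r2 r3] := rtP h2; split=> // [|C /h3/r3//].
by rewrite expnS exprM expr2 r1.
Qed.

Lemma rtn_lip j X X' : near1 X -> near1 X' -> nrm (rtn j X - rtn j X') <= nrm (X - X').
Proof.
move=> X1 X1'; elim: j => [|j] //=; apply: le_trans; apply: rt_lip.
  by have [] := rtnP j X1.
by have [] := rtnP j X1'.
Qed.

Lemma rtn_unitary j X : near1 X -> X \is unitarymx -> rtn j X \is unitarymx.
Proof.
move=> X1 Xu; elim: j => [|j IH] //=; apply: rt_unitary => //.
by have [] := rtnP j X1.
Qed.

(** Halving the parameter of a one-parameter subgroup gives a square root near [1], which by
    uniqueness is the chosen one. *)
Lemma rtn_1psg j (c : R -> M) (x : R) : {morph c : s t / s + t >-> s * t} ->
  (forall t, 0 <= t <= x -> near1 (c t)) -> 0 <= x ->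
  rtn j (c x) = c (x * 2^-1 ^+ j).
Proof.
move=> cD c1 x0; elim: j => [|j IH] /=; first by rewrite mulr1.
have h k : near1 (c (x * 2^-1 ^+ k)).
  apply: c1; rewrite mulr_ge0 ?exprn_ge0 ?invr_ge0 //= ler_piMr //.
  by rewrite exprn_ile1 // ?invr_ge0 // invf_le1 // ler1n.
rewrite IH; apply: rt_unique => //; rewrite -cD; congr c; rewrite exprS; lra.
Qed.

End Root.

(** * Bounded frame functions *)

HB.lock Definition transv (R : realType) (n : nat) (a b : 'I_n.+1) (s : Cplx R) :
  'M[Cplx R]_n.+1 := 1 + s *: delta_mx a b.

Section FrameFunction.
Variables (R : realType) (n : nat).
Local Notation M := 'M[Cplx R]_n.+1.
Local Notation transv := (@transv R n).
Implicit Types (g u X : M) (a b c i : 'I_n.+1).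

Lemma nrm_mulrn_bounded_eq0 X (c : R) : (forall k, nrm (X *+ k) <= c) -> X = 0.
Proof.
move=> h; apply: nrm_eq0; apply/eqP; rewrite eq_le nrm_ge0 andbT.
apply: (@le0_halving _ _ c) => k.
rewrite exprVn ler_pdivlMr ?exprn_gt0 // -natrX.
have := h (2 ^ k)%N; rewrite -scaler_nat nrmZ mulrC.
by rewrite -(rmorph_nat (real_complex R)) cabs_real ger0_norm ?ler0n.
Qed.

Lemma mul_delta a b c d : delta_mx a b * delta_mx c d = delta_mx a d *+ (b == c) :> M.
Proof. by rewrite -mulmxE mul_delta_mx_cond. Qed.

Lemma transvM a b c d s t : transv a b s * transv c d t =
  1 + s *: delta_mx a b + t *: delta_mx c d + (s * t) *: (delta_mx a d *+ (b == c)).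
Proof.
rewrite transv.unlock mulrDl !mulrDr !mul1r !mulr1 -scalerAl -scalerAr scalerA mul_delta.
rewrite -!addrA.
apply: congr1.
exact: addrCA.
Qed.

Lemma transvD a b s t : a != b -> transv a b s * transv a b t = transv a b (s + t).
Proof.
by move=> ab; rewrite transvM eq_sym (negbTE ab) mulr0n scaler0 addr0 -addrA -scalerDl
  transv.unlock.
Qed.

Lemma transv0 a b : transv a b 0 = 1.
Proof. by rewrite transv.unlock scale0r addr0. Qed.

Lemma transv_unit a b s : a != b -> transv a b s \is a GRing.unit.
Proof.
move=> ab; apply/unitrP; exists (transv a b (- s)).
by rewrite !transvD // addrN addNr transv0.
Qed.

Lemma mul_transv_unit g a b s : a != b -> g \is a GRing.unit ->
  g * transv a b s \is a GRing.unit.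
Proof. by move=> ab gU; rewrite unitrMl // transv_unit. Qed.

Lemma transv_comm a b c d s t : b != c -> d != a ->
  GRing.comm (transv a b s) (transv c d t).
Proof.
move=> bc da; rewrite /GRing.comm !transvM (negbTE bc) (negbTE da).
rewrite !mulr0n !scaler0 !addr0.
exact: addrAC.
Qed.

Lemma transv_delta a b c d s :
  transv a b s * delta_mx c d = delta_mx c d + s *: (delta_mx a d *+ (b == c)).
Proof. by rewrite transv.unlock mulrDl mul1r -scalerAl mul_delta. Qed.

Lemma delta_transv a b c d s :
  delta_mx c d * transv a b s = delta_mx c d + s *: (delta_mx c b *+ (d == a)).
Proof. by rewrite transv.unlock mulrDr mulr1 -scalerAr mul_delta. Qed.

Lemma transv_comm_delta a b i s : i != a -> i != b ->
  GRing.comm (transv a b s) (delta_mx i i).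
Proof.
by move=> ia ib; rewrite /GRing.comm transv_delta delta_transv (negbTE ia) eq_sym (negbTE ib).
Qed.

(** [P g i] is a matrix attached to the [i]-th idempotent of the frame [g]; [P_conj] says that it
    depends on [g * delta_mx i i * g^-1] only. *)
Variables (P : M -> 'I_n.+1 -> M) (bound : R).

Hypothesis P_sum : forall g, g \is a GRing.unit -> \sum_i P g i = 1.
Hypothesis P_bound : forall g i, g \is a GRing.unit -> nrm (P g i) <= bound.
Hypothesis P_orth : forall i j, i != j -> P 1 i * P 1 j = 0.
Hypothesis P_conj : forall g u i j, g \is a GRing.unit -> u \is a GRing.unit ->
  u * delta_mx i i = delta_mx j j * u -> P (g * u) i = P g j.

Lemma frame_value_transv_ne g a b i s : g \is a GRing.unit -> a != b ->
  i != a -> i != b -> P (g * transv a b s) i = P g i.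
Proof.
move=> gU ab ia ib; apply: P_conj => //; first exact: transv_unit.
exact: transv_comm_delta.
Qed.

Section Transvection.
Variables (a b c : 'I_n.+1).
Hypotheses (ab : a != b) (ac : a != c) (bc : b != c).

(* By [transv_defect] the defect can be read off at [b] or at [a], where it is
   insensitive to [T_ac] and to [T_cb] respectively.  The commutator of these is
   [T_ab], so the defect is also invariant under [g -> g * T_ab r]: it is additive
   in [s]. *)
Local Definition D g s := P (g * transv a b s) b - P g b.

(** [T_ab] alters only the values at [a] and [b], and the total stays [1]: what [b] gains, [a]
    loses. *)
Lemma transv_defect g s : g \is a GRing.unit -> D g s = P g a - P (g * transv a b s) a.
Proof.
move=> gU; pose S := \sum_(i | (i != a) && (i != b)) P g i.
have eS h : h \is a GRing.unit -> (forall i, i != a -> i != b -> P h i = P g i) ->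
    P h a + P h b = 1 - S.
  move=> hU hg; rewrite -(P_sum hU) (bigD1 a) //= (bigD1 b) ?(eq_sym b) //= addrA.
  by rewrite (eq_bigr (P g)) ?addrK // => i /andP[ia ib]; apply: hg.
have e := etrans (eS g gU (fun _ _ _ => erefl)) (esym (eS _ (mul_transv_unit s ab gU)
  (fun i => @frame_value_transv_ne g a b i s gU ab))).
by apply/eqP; rewrite subr_eq addrAC e addrAC subrr add0r.
Qed.

Lemma transv_defect_cb g s r : g \is a GRing.unit -> D (g * transv c b r) s = D g s.
Proof.
move=> gU; have cb : c != b by rewrite eq_sym.
have hU x y t : x != y -> g * transv x y t \is a GRing.unit.
  by move=> xy; apply: mul_transv_unit.
rewrite (transv_defect _ (hU _ _ _ cb)) (transv_defect _ gU).
rewrite (frame_value_transv_ne _ gU cb ac ab) -mulrA.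
rewrite transv_comm ?(eq_sym b) // mulrA.
by rewrite (frame_value_transv_ne _ (hU _ _ _ ab) cb ac ab).
Qed.

Lemma transv_defect_ac g s r : g \is a GRing.unit -> D (g * transv a c r) s = D g s.
Proof.
move=> gU; have hU x y t : x != y -> g * transv x y t \is a GRing.unit.
  by move=> xy; apply: mul_transv_unit.
have ba : b != a by rewrite eq_sym.
have ca : c != a by rewrite eq_sym.
rewrite /D (frame_value_transv_ne _ gU ac ba bc) -mulrA.
rewrite transv_comm // mulrA.
by rewrite (frame_value_transv_ne _ (hU _ _ _ ab) ac ba bc).
Qed.

Lemma transv_defect_ab g s r : g \is a GRing.unit -> D (g * transv a b r) s = D g s.
Proof.
move=> gU; have hU h x y t : h \is a GRing.unit -> x != y -> h * transv x y t \is a GRing.unit.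
  by move=> hU xy; apply: mul_transv_unit.
have cb : c != b by rewrite eq_sym.
apply: etrans (esym (transv_defect_cb s 1 (hU _ _ _ r gU ab))) _.
apply: etrans (esym (transv_defect_ac s r (hU _ _ _ 1 (hU _ _ _ r gU ab) cb))) _.
apply: etrans _ (transv_defect_ac s r gU).
apply: etrans _ (transv_defect_cb s 1 (hU _ _ _ r gU ac)).
(* The commutator relation of elementary matrices, with parameters [1] and [r] so that the
   commutator is [transv a b r]. *)
suff e : transv a b r * (transv c b 1 * transv a c r) = transv a c r * transv c b 1.
  by rewrite -!mulrA e.
rewrite !transvM eqxx (eq_sym b a) (negbTE ab) mulr0n scaler0 addr0 mulr1n.
rewrite transv.unlock mulrDl mul1r -scalerAl !mulrDr mulr1 -!scalerAr !mul_delta.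
rewrite (negbTE bc) eq_sym (negbTE ab) !mulr0n !scaler0 !addr0 mulr1 scale1r.
rewrite -!addrA; apply: congr1; exact: addrCA.
Qed.

(** By additivity the multiples of [D g s] are again defects, so they are bounded by
    [bound + bound]; a matrix with bounded multiples is [0]. *)
Lemma frame_value_transv_r g s : g \is a GRing.unit -> P (g * transv a b s) b = P g b.
Proof.
move=> gU; apply/eqP; rewrite -subr_eq0 -/(D g s); apply/eqP.
apply: (@nrm_mulrn_bounded_eq0 _ (bound + bound)) => k.
have -> : D g s *+ k = D g (s *+ k).
  elim: k => [|k IH]; first by rewrite /D !mulr0n transv0 mulr1 subrr.
  rewrite mulrS mulrS IH -(transv_defect_ab (s *+ k) s gU) /D -mulrA (transvD _ _ ab).
  by rewrite addrC addrA subrK.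
have hU := mul_transv_unit (s *+ k) ab gU.
apply: le_trans (nrmD _ _) _; rewrite nrmN.
exact: lerD (P_bound _ hU) (P_bound _ gU).
Qed.

Lemma frame_value_transv_l g s : g \is a GRing.unit -> P (g * transv a b s) a = P g a.
Proof.
move=> gU; have := transv_defect s gU; rewrite /D frame_value_transv_r // subrr.
by move/eqP; rewrite eq_sym subr_eq0 => /eqP.
Qed.

End Transvection.

Hypothesis n2 : (2 <= n)%N.

Lemma frame_value_transv g a b i s : g \is a GRing.unit -> a != b ->
  P (g * transv a b s) i = P g i.
Proof.
move=> gU ab.
(* There are at least three indices, which supplies the auxiliary [c] of the commutator argument. *)
have /card_gt0P[c] : (0 < #|predC (pred2 a b)|)%N.
  by rewrite -(ltn_add2l #|pred2 a b|) addn0 cardC card2 ab card_ord.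
rewrite !inE negb_or => /andP[ca cb]; rewrite eq_sym in ca; rewrite eq_sym in cb.
have [->|ia] := eqVneq i a; first exact: (frame_value_transv_l ab ca cb).
have [->|ib] := eqVneq i b; first exact: (frame_value_transv_r ab ca cb).
exact: frame_value_transv_ne.
Qed.

Lemma frame_value_const a b : P 1 a = P 1 b.
Proof.
have [->//|ab] := eqVneq a b.
have ba : b != a by rewrite eq_sym.
(* [w] is the Weyl element that swaps the basis vectors [a] and [b] up to sign. It intertwines
   [E_aa] and [E_bb], and as a product of transvections it leaves [P] unchanged. *)
pose w := transv a b 1 * transv b a (-1) * transv a b 1.
have wU : w \is a GRing.unit by rewrite !mul_transv_unit ?transv_unit.
have -> : P 1 b = P w b.
  by rewrite -[w]mul1r !mulrA !frame_value_transv ?mul_transv_unit ?unitr1.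
apply/esym; rewrite -[w]mul1r; apply: P_conj; rewrite ?unitr1 // /w.
rewrite -!mulrA transv_delta eqxx mulr1n scale1r mulrDr !transv_delta eqxx (negbTE ab).
rewrite mulr0n scaler0 addr0 mulr1n scaleN1r addrCA subrr addr0.
rewrite transv_delta (negbTE ba) mulr0n scaler0 addr0.
rewrite !mulrA delta_transv eqxx mulr1n scale1r mulrDl !delta_transv eqxx (negbTE ab).
rewrite mulr0n scaler0 addr0 mulr1n scaleN1r addrCA subrr addr0.
by rewrite delta_transv (negbTE ba) mulr0n scaler0 addr0.
Qed.

(** All [P 1 i] equal one matrix [F] with [F * F = 0] and [(n + 1) F = 1]; multiplying the latter by
    [F] gives [F = 0], a contradiction. *)
Lemma no_bounded_frame_function : False.
Proof.
have lt1 : (1 < n.+1)%N by rewrite ltnS ltnW.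
pose a : 'I_n.+1 := ord0; pose b : 'I_n.+1 := Ordinal lt1.
have F0 : P 1 a * P 1 a = 0 by rewrite {2}(frame_value_const a b) P_orth.
have := P_sum (unitr1 _); rewrite (eq_bigr (fun=> P 1 a)) => [|i _]; last first.
  exact: frame_value_const.
rewrite sumr_const => h; have := congr1 (fun X => P 1 a * X) h.
rewrite /= mulrnAr F0 mul0rn mulr1 => Pa0; move/eqP: h.
by rewrite -Pa0 mul0rn eq_sym oner_eq0.
Qed.

End FrameFunction.

(** * Convergence in norm and ranks of idempotents *)

Lemma cvg_mx_entries (K : numClosedFieldType) m n (T : Type) (G : set_system T)
    (FG : Filter G) (F : T -> 'M[K]_(m, n)) (L : 'M[K]_(m, n)) :
  F @ G --> L <->
  forall e : K, 0 < e -> \forall x \near G, forall i j, `|L i j - F x i j| < e.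
Proof.
split=> [FL e e0|h A /nbhs_ballP[e /= e0 eA]].
  have nL : nbhs L (ball L e) by apply: nbhsx_ballx.
  have FB : \forall x \near G, ball L e (F x) by exact: FL nL.
  by apply: filterS FB => x [_ hx].
by apply: filterS (h e e0) => x hx; apply: eA; split.
Qed.

Section NormConvergence.
Variables (R : realType) (n : nat).
Local Notation M := 'M[Cplx R]_n.+1.

(** Convergence with real radii, so that estimates stay in [R]; [cvg_ncvg] and [ncvg_cvg] identify
    it with convergence in the product topology. *)
Definition ncvg (T : Type) (G : set_system T) (F : T -> M) (L : M) :=
  forall e : R, 0 < e -> \forall x \near G, nrm (F x - L) <= e.

Section Filter.
Variables (T : Type) (G : set_system T).
Context {FG : Filter G}.
Implicit Types F H : T -> M.

Lemma ncvg_le F (L : M) (H : T -> M) L' (c : R) : ncvg G F L ->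
  (\forall x \near G, nrm (H x - L') <= c * nrm (F x - L)) -> ncvg G H L'.
Proof.
move=> FL h e e0; have c0 : 0 < `|c| + 1 by rewrite ltr_pwDr.
have := FL (e / (`|c| + 1)) (divr_gt0 e0 c0); apply: filterS2 h => x h1 h2.
apply: le_trans h1 _; rewrite ler_pdivlMr // in h2.
have := ler_wpM2r (nrm_ge0 (F x - L)) (ler_norm c).
have := nrm_ge0 (F x - L); lra.
Qed.

Lemma ncvg_cst (L : M) : ncvg G (fun=> L) L.
Proof. by move=> e e0; near=> x; rewrite subrr nrm0 ltW. Unshelve. all: by end_near. Qed.

Lemma ncvgD F F' L L' : ncvg G F L -> ncvg G F' L' ->
  ncvg G (fun x => F x + F' x) (L + L').
Proof.
move=> FL FL' e e0; have e2 : 0 < e / 2 by rewrite divr_gt0.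
apply: filterS2 (FL _ e2) (FL' _ e2) => x h h'.
have := nrmD (F x - L) (F' x - L'); rewrite addrACA -opprD; lra.
Qed.

Lemma ncvgZ a F L : ncvg G F L -> ncvg G (fun x => a *: F x) (a *: L).
Proof.
move=> FL; apply: (ncvg_le (c := cabs a) FL); near=> x.
by rewrite -scalerBr nrmZ.
Unshelve. all: by end_near. Qed.

Lemma ncvgM F F' L L' : ncvg G F L -> ncvg G F' L' ->
  ncvg G (fun x => F x * F' x) (L * L').
Proof.
move=> FL FL'.
have h1 : ncvg G (fun x => (F x - L) * F' x) 0.
  apply: (ncvg_le (c := nrm L' + 1) FL); apply: filterS (FL' _ ltr01) => x h.
  rewrite subr0 mulrC; apply: le_trans (nrmM _ _) _.
  rewrite ler_wpM2l ?nrm_ge0 //; have := nrmD L' (F' x - L').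
  by rewrite addrC subrK; lra.
have h2 : ncvg G (fun x => L * F' x) (L * L').
  by apply: (ncvg_le (c := nrm L) FL'); near=> x; rewrite -mulrBr nrmM.
have := ncvgD h1 h2; rewrite add0r.
by congr (ncvg _ _ _); apply: funext => x; rewrite mulrBl subrK.
Unshelve. all: by end_near. Qed.

Lemma ncvg_prod (s : seq nat) (F : nat -> T -> M) (L : nat -> M) :
  (forall k, ncvg G (F k) (L k)) ->
  ncvg G (fun x => \prod_(k <- s) F k x) (\prod_(k <- s) L k).
Proof.
move=> FL; elim: s => [|k s IH].
  by rewrite big_nil; under eq_fun do rewrite big_nil; apply: ncvg_cst.
by rewrite big_cons; under eq_fun do rewrite big_cons; apply: ncvgM.
Qed.

Lemma ncvg_sum (I : Type) (s : seq I) (F : I -> T -> M) (L : I -> M) :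
  (forall k, ncvg G (F k) (L k)) ->
  ncvg G (fun x => \sum_(k <- s) F k x) (\sum_(k <- s) L k).
Proof.
move=> FL; elim: s => [|k s IH].
  by rewrite big_nil; under eq_fun do rewrite big_nil; apply: ncvg_cst.
by rewrite big_cons; under eq_fun do rewrite big_cons; apply: ncvgD.
Qed.

Lemma ncvgX k F L : ncvg G F L -> ncvg G (fun x => F x ^+ k) (L ^+ k).
Proof.
move=> FL; elim: k => [|k IH]; first exact: ncvg_cst.
by rewrite exprS; under eq_fun do rewrite exprS; apply: ncvgM.
Qed.

(** With [B = L^-1], use [X^-1 - B = B * (L - X) * X^-1]: once [|X - L| <= 1 / (2 c)], it first
    bounds [|X^-1|] by [2 c], then the difference by a multiple of [|X - L|]. *)
Lemma ncvgV F L : ncvg G F L -> L \is a GRing.unit ->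
  (\forall x \near G, F x \is a GRing.unit) -> ncvg G (fun x => (F x)^-1) L^-1.
Proof.
move=> FL LU FU; set B := L^-1; pose c := nrm B + 1.
have c0 : 0 < c by rewrite ltr_pwDr // nrm_ge0.
have h : 0 < (2 * c)^-1 by rewrite invr_gt0 mulr_gt0.
apply: (ncvg_le (c := 2 * c * c) FL); apply: filterS2 FU (FL _ h) => x xU.
set d := nrm (F x - L) => hd.
have e : (F x)^-1 - B = B * (L - F x) * (F x)^-1.
  by rewrite mulrBr mulVr // mulrBl mul1r mulrK.
have d2 : d * c <= 2^-1 by rewrite -ler_pdivlMr // -invfM.
have hB : nrm B <= c by rewrite /c; lra.
have e1 : nrm ((F x)^-1 - B) <= c * d * nrm (F x)^-1.
  rewrite e; apply: le_trans (nrmM _ _) _; apply: ler_wpM2r; first exact: nrm_ge0.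
  apply: le_trans (nrmM _ _) _; rewrite nrm_distC.
  by apply: ler_wpM2r => //; apply: nrm_ge0.
have e2 := nrmD ((F x)^-1 - B) B; rewrite subrK in e2.
have e3 : c * d * nrm (F x)^-1 <= 2^-1 * nrm (F x)^-1.
  by rewrite ler_wpM2r ?nrm_ge0 // mulrC.
have e4 : nrm (F x)^-1 <= 2 * c by lra.
apply: le_trans e1 _; rewrite -(mulrA 2) mulrC -!mulrA.
have : nrm (F x)^-1 * (c * d) <= 2 * c * (c * d).
  by apply: ler_wpM2r => //; rewrite mulr_ge0 ?nrm_ge0 // ltW.
lra.
Qed.

Lemma ncvg_rtn j F L : near1 L -> (\forall x \near G, near1 (F x)) -> ncvg G F L ->
  ncvg G (fun x => rtn j (F x)) (rtn j L).
Proof.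
move=> L1 F1 FL; apply: (ncvg_le (c := 1) FL); apply: filterS F1 => x F1.
by rewrite mul1r rtn_lip.
Qed.

Lemma cvg_ncvg F L : F @ G --> L -> ncvg G F L.
Proof.
move=> FL e e0; pose d : R := e / (n.+1 * n.+1)%:R.
have d0 : 0 < d by rewrite divr_gt0 // ltr0n.
have dC : 0 < (d%:C%C : Cplx R) by rewrite ltcR.
move/cvg_mx_entries: FL => /(_ _ dC); apply: filterS => x h.
have -> : e = d *+ (n.+1 * n.+1) by rewrite -mulr_natr divfK // pnatr_eq0.
rewrite nrm_distC; apply: nrm_le_bound => i j; have := h i j.
by rewrite -cabsE !mxE ltcR => /ltW.
Qed.

Lemma ncvg_cvg F L : ncvg G F L -> F @ G --> L.
Proof.
move=> FL; apply/cvg_mx_entries => e e0; have er : e = (complex.Re e)%:C%C.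
  by apply/esym; apply: RRe_real (gtr0_real e0).
have r0 : 0 < complex.Re e by rewrite -ltcR -er.
have r2 : 0 < complex.Re e / 2 by rewrite divr_gt0.
apply: filterS (FL _ r2) => x h i j; rewrite er -cabsE ltcR.
have := cabs_le_nrm (L - F x) i j; rewrite nrm_distC !mxE; lra.
Qed.

End Filter.

Definition idem (P : M) := P * P = P.

(** If [C] spans the part of the row space of [P] killed by [Q], then [C = C * (P - Q)], which
    forces [C = 0]; so [Q] is injective on that row space. *)
Lemma idem_rank_le P Q : idem P -> idem Q -> nrm (P - Q) < 1 -> (\rank P <= \rank Q)%N.
Proof.
move=> iP iQ PQ; apply: leq_trans (mxrankM_maxr P Q).
rewrite -(mxrank_mul_ker P Q); set C : M := (P :&: kermx Q)%MS.
suff -> : C = 0 by rewrite mxrank0 addn0.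
have CP : C * P = C.
  by have /submxP[D ->] : (C <= P)%MS by [exact: capmxSl]; rewrite -mulmxE -mulmxA mulmxE iP.
have CQ : C * Q = 0.
  by apply/eqP; rewrite -mulmxE -sub_kermx capmxSr.
have := nrmM C (P - Q); rewrite mulrBr CP CQ subr0 => h.
apply: nrm_eq0; apply/eqP; rewrite eq_le nrm_ge0 andbT leNgt; apply/negP => C0.
by have := h; rewrite -subr_ge0 -[X in _ - X]mulr1 -mulrBr pmulr_rge0 // subr_ge0 leNgt PQ.
Qed.

(** The set where [r] equals [r 0] is open and closed, and the segment is connected. *)
Lemma locally_constant_segment (r : R -> nat) :
  (forall t, \forall t' \near t, r t' = r t) -> r 0 = r 1.
Proof.
move=> h; pose B := `[0, 1]%classic `&` [set t | r t = r 0].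
have : B = `[0, 1]%classic.
  apply: (@segment_connected R 0 1).
  - by exists 0; split => //=; rewrite in_itv /= lexx ler01.
  - exists [set t | r t = r 0] => //; rewrite openE => t /= <-; exact: h.
  - exists [set t | r t = r 0] => //; rewrite -[X in closed X]setCK; apply: open_closedC.
    rewrite openE => t tr; apply: filterS (h t) => t' e e0.
    by apply: tr; rewrite /= -e.
by move=> /seteqP[_ /(_ 1)] []//=; rewrite in_itv /= lexx ler01.
Qed.

Lemma idem_rank_segment (f : R -> M) : (forall t, idem (f t)) ->
  (forall t, ncvg (nbhs t) f (f t)) -> \rank (f 0) = \rank (f 1).
Proof.
move=> fi fc; apply: (locally_constant_segment (r := fun t => \rank (f t))) => t.
have h : 0 < 2^-1 :> R by rewrite invr_gt0.
apply: filterS (fc t _ h) => t' d; apply/eqP; rewrite eqn_leq.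
have d1 : nrm (f t' - f t) < 1 by lra.
by rewrite !idem_rank_le // nrm_distC.
Qed.

Lemma ncvg_comp (T : Type) (U : topologicalType) (G : set_system T) (h : T -> U) (y : U)
    (F : U -> M) L : h @ G --> y -> ncvg (nbhs y) F L -> ncvg G (F \o h) L.
Proof. by move=> hy FL d d0; exact: hy (FL d d0). Qed.

Lemma idemM (P Q : M) : GRing.comm P Q -> idem P -> idem Q -> idem (P * Q).
Proof. by move=> c iP iQ; rewrite /idem mulrA -(mulrA P) -c mulrA iP -mulrA iQ. Qed.

Lemma idem_sum (I : finType) (F : I -> M) : (forall i, idem (F i)) ->
  (forall i k, i != k -> F i * F k = 0) -> idem (\sum_i F i).
Proof.
move=> Fi F0; rewrite /idem mulr_suml; apply: eq_bigr => i _.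
rewrite mulr_sumr (bigD1 i) //= (Fi i) big1 ?addr0 // => k ki.
by rewrite F0 // eq_sym.
Qed.

Lemma sum_delta_mx : \sum_i delta_mx i i = 1 :> M.
Proof.
apply/matrixP => a b; rewrite summxE (bigD1 a) //= big1 ?addr0 => [|i ia].
  by rewrite !mxE eqxx eq_sym.
by rewrite mxE eq_sym (negbTE ia).
Qed.

Lemma idem_rank_const (f : R -> M) t : (forall t, idem (f t)) ->
  (forall t, ncvg (nbhs t) f (f t)) -> \rank (f t) = \rank (f 0).
Proof.
(* Rescaling the parameter turns the segment from [0] to [t] into the unit segment. *)
move=> fi fc; have := @idem_rank_segment (fun x => f (t * x)).
rewrite mulr0 mulr1 => -> // x.
have tc : t * y @[y --> x] --> t * x by exact: mulrl_continuous.
exact: (ncvg_comp tc (fc (t * x))).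
Qed.

End NormConvergence.

(** * Holonomy of commuting loops *)

Section Holonomy.
Variables (R : realType) (n : nat).
Local Notation M := 'M[Cplx R]_n.+1.
Implicit Types (C U e : M) (a : R -> M).

Lemma expr_prod_comm (F : nat -> M) (s : seq nat) p :
  (forall k l, GRing.comm (F k) (F l)) ->
  (\prod_(k <- s) F k) ^+ p = \prod_(k <- s) F k ^+ p.
Proof.
move=> FC; elim: s => [|k s IH]; first by rewrite !big_nil expr1n.
rewrite !big_cons exprMn_comm ?IH //.
by elim/big_rec: _ => [|l x _ h]; [exact: commr1 | exact: commrM].
Qed.

Lemma mulr_unitary (U V : M) : U \is unitarymx -> V \is unitarymx -> U * V \is unitarymx.
Proof. exact: mul_unitarymx. Qed.

Lemma invr_unitary (U : M) : U \is unitarymx -> U^-1 \is unitarymx.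
Proof.
by move=> Uu; rewrite -[U^-1]/(invmx U) (invmx_unitary Uu) trmxC_unitary.
Qed.

Lemma unitary1 : (1 : M) \is unitarymx.
Proof. by apply/unitarymxP; rewrite trmx1 map_mx1 mulmx1. Qed.

(* [holonomy j m a] is the [2 ^ j]-th root of the product of the increments of [a]
   along the subdivision [k / m] that is obtained by taking the root of each factor. *)
Definition increment m a k : M := a (k.+1%:R / m%:R) * (a (k%:R / m%:R))^-1.

Definition holonomy j m a : M := \prod_(k <- index_iota 0 m) rtn j (increment m a k).

Section Loop.
Variables (j m : nat) (a : R -> M).
Hypothesis a_near1 : forall k, (k < m)%N -> near1 (increment m a k).

Lemma comm_holonomy C : (forall s, GRing.comm C (a s)) -> GRing.comm C (holonomy j m a).
Proof.
move=> Ca; rewrite /holonomy big_seq.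
elim/big_rec: _ => [|k x]; first exact: commr1.
rewrite mem_index_iota => /andP[_ km] h; apply: commrM => //.
have [_ _] := rtnP j (a_near1 km); apply.
by apply: commrM => //; apply: commrV.
Qed.

Lemma holonomy_unitary : (forall s, a s \is unitarymx) -> holonomy j m a \is unitarymx.
Proof.
move=> au; rewrite /holonomy big_seq.
elim/big_rec: _ => [|k x]; first exact: unitary1.
rewrite mem_index_iota => /andP[_ km] h; apply: mulr_unitary h.
apply: rtn_unitary; first exact: a_near1.
exact: mulr_unitary (au _) (invr_unitary (au _)).
Qed.

(** All factors commute, so the power replaces each root by its increment, and the increments
    telescope to [a 1 * (a 0)^-1 = 1]. *)
Lemma holonomy_exp : (0 < m)%N -> (forall s, a s \is a GRing.unit) ->
  (forall s t, GRing.comm (a s) (a t)) -> a 1 = a 0 -> holonomy j m a ^+ (2 ^ j) = 1.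
Proof.
move=> m0 aU aC a10.
have aVC s t : GRing.comm (a s) (a t)^-1 by apply: commrV.
have prodE p : \prod_(k <- index_iota 0 p) increment m a k = a (p%:R / m%:R) * (a 0)^-1.
  elim: p => [|p IH]; first by rewrite big_nil mul0r divrr.
  rewrite big_nat_recr //= IH /increment (aVC _ 0) -mulrA (mulrA _ _ _^-1).
  by rewrite (aC (p%:R / _)) mulrK // -aVC.
have -> : 1 = \prod_(k <- index_iota 0 m) increment m a k.
  by rewrite prodE divff ?a10 ?divrr // pnatr_eq0 -lt0n.
(* The value [1] beyond [m] makes the factors commute for all pairs of indices, as [expr_prod_comm]
   asks. *)
pose F k := if (k < m)%N then rtn j (increment m a k) else 1.
have FE : holonomy j m a = \prod_(k <- index_iota 0 m) F k.
  by rewrite /holonomy !big_seq; apply: eq_bigr => k; rewrite mem_index_iota /F => /andP[_ ->].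
have incC C k : (forall s, GRing.comm C (a s)) -> GRing.comm C (increment m a k).
  by move=> h; apply: commrM => //; apply: commrV.
rewrite FE expr_prod_comm => [|k l]; last first.
  rewrite /F; case: ifP => [km|_]; last exact: commr_sym (commr1 _).
  case: ifP => [lm|_]; last exact: commr1.
  have [_ _ ck] := rtnP j (a_near1 km); have [_ _ cl] := rtnP j (a_near1 lm).
  by apply: cl; apply: (incC) => s; apply/commr_sym; apply: ck; apply: incC.
rewrite !big_seq; apply: eq_bigr => k; rewrite mem_index_iota => /andP[_ km].
by rewrite /F km; have [] := rtnP j (a_near1 km).
Qed.

End Loop.

(** Every increment is [a (1 / m)], with root [a (1 / (m 2 ^ j))]; the product of [m] copies is
    [a (2^-j)]. *)
Lemma holonomy_1psg j m a : (0 < m)%N -> {morph a : s t / s + t >-> s * t} ->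
  (forall s, a s \is a GRing.unit) ->
  (forall s, 0 <= s <= m%:R^-1 -> near1 (a s)) -> holonomy j m a = a (2^-1 ^+ j).
Proof.
move=> m0 aD aU a1; have m0R : m%:R != 0 :> R by rewrite pnatr_eq0 -lt0n.
have incE k : increment m a k = a m%:R^-1.
  by rewrite /increment -natr1 mulrDl mul1r addrC aD mulrK.
have aX s p : a s ^+ p.+1 = a (s *+ p.+1).
  by elim: p => [|p IH]; rewrite ?expr1 // exprS IH -aD -mulrS.
rewrite /holonomy; under eq_bigr do rewrite incE rtn_1psg ?invr_ge0 //.
case: m m0 m0R {a1 incE} => // p _ p0.
by rewrite prodr_const_nat subn0 aX -mulrnAl -mulr_natr mulVf // mul1r.
Qed.

(** For a fixed subdivision only finitely many [s] enter, so continuity in [t] for each fixed [s] is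
    enough. *)
Lemma ncvg_holonomy j m (A : R -> R -> M) t :
  (forall t, forall k, (k < m)%N -> near1 (increment m (A t) k)) ->
  (forall t s, A t s \is a GRing.unit) ->
  (forall s, ncvg (nbhs t) (A^~ s) (A t s)) ->
  ncvg (nbhs t) (fun t => holonomy j m (A t)) (holonomy j m (A t)).
Proof.
move=> A1 AU Ac.
pose F k t := if (k < m)%N then rtn j (increment m (A t) k) else 1.
have FE t' : holonomy j m (A t') = \prod_(k <- index_iota 0 m) F k t'.
  by rewrite /holonomy !big_seq; apply: eq_bigr => k; rewrite mem_index_iota /F => /andP[_ ->].
rewrite FE; under eq_fun do rewrite FE.
apply: (@ncvg_prod R n _ _ _ _ F (F^~ t)) => k; rewrite /F; case: ifP => km; last exact: ncvg_cst.
apply: ncvg_rtn; first exact: A1.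
  by apply: filterE => t'; apply: A1.
by apply: ncvgM => //; apply: ncvgV => //; apply: filterE.
Qed.

(* The spectral projection of [U] for the eigenvalue [w^-1], when [U] and [w]
   both have order dividing [p]. *)
Definition root_proj p (w : Cplx R) U : M :=
  p%:R^-1 *: \sum_(k <- index_iota 0 p) (w *: U) ^+ k.

Section RootProj.
Variables (p : nat) (w : Cplx R).
Hypotheses (p_gt0 : (0 < p)%N) (w_exp : w ^+ p = 1).

(** For [V = w U] the sum [S] of the powers of [V] over a full period satisfies [V * S = S], hence
    [S * S = p S]. *)
Lemma root_proj_idem U : U ^+ p = 1 -> idem (root_proj p w U).
Proof.
move=> Up; set V := w *: U; have Vp : V ^+ p = 1 by rewrite exprZn w_exp Up scale1r.
set S := \sum_(k <- index_iota 0 p) V ^+ k.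
have VS : V * S = S.
  have e : S + V ^+ p = 1 + V * S.
    rewrite -big_nat_recr //= big_nat_recl //= expr0 mulr_sumr; congr (_ + _).
    by apply: eq_bigr => k _; rewrite exprS.
  by apply: (addrI 1); rewrite -e Vp addrC.
have VkS k : V ^+ k * S = S by elim: k => [|k IH]; rewrite ?mul1r // exprSr -mulrA VS.
have SS : S * S = S *+ p.
  by rewrite {1}/S mulr_suml (eq_bigr (fun=> S)) // big_const_nat subn0 iter_addr_0.
have p0 : p%:R != 0 :> Cplx R by rewrite pnatr_eq0 -lt0n.
rewrite /idem /root_proj -/V -/S -scalerAl -scalerAr SS -[S *+ p]scaler_nat.
by rewrite [in X in _ *: X]scalerA mulVf // scale1r.
Qed.

Lemma comm_root_proj C U : GRing.comm C U -> GRing.comm C (root_proj p w U).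
Proof.
have cZ (x : Cplx R) D : GRing.comm C D -> GRing.comm C (x *: D).
  by move=> CD; rewrite /GRing.comm -scalerAr -scalerAl CD.
move=> CU; apply: (cZ); elim/big_rec: _ => [|k x _ h]; first exact: commr0.
by apply: commrD => //; apply: commrX; apply: cZ.
Qed.

Lemma ncvg_root_proj (T : Type) (G : set_system T) (FG : Filter G) (F : T -> M) L :
  ncvg G F L -> ncvg G (fun x => root_proj p w (F x)) (root_proj p w L).
Proof.
by move=> FL; apply: ncvgZ; apply: ncvg_sum => k; apply: ncvgX; apply: ncvgZ.
Qed.

(** The powers of [e + q (1 - e)] are [e + q ^ k (1 - e)], and the sum of [q ^ k] over a full period
    vanishes for [q != 1]. *)
Lemma root_proj_eigen e (q : Cplx R) : idem e -> q ^+ p = 1 -> q != 1 ->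
  root_proj p w (w^-1 *: (e + q *: (1 - e))) = e.
Proof.
move=> ie qp q1; have w0 : w != 0.
  by apply/eqP => w0; move/eqP: w_exp; rewrite w0 expr0n eqn0Ngt p_gt0 eq_sym oner_eq0.
rewrite /root_proj scalerA divff // scale1r.
have e1 : e * (1 - e) = 0 by rewrite mulrBr mulr1 ie subrr.
have e2 : (1 - e) * e = 0 by rewrite mulrBl mul1r ie subrr.
have e3 : (1 - e) * (1 - e) = 1 - e by rewrite mulrBr mulr1 e2 subr0.
have powE k : (e + q *: (1 - e)) ^+ k = e + q ^+ k *: (1 - e).
  elim: k => [|k IH]; first by rewrite !expr0 scale1r addrC subrK.
  rewrite exprS IH mulrDl !mulrDr -!scalerAl -!scalerAr ie e1 e2 e3.
  by rewrite !scaler0 addr0 add0r scalerA -exprS.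
under eq_bigr do rewrite powE.
rewrite big_split /= -scaler_suml.
have -> : \sum_(k <- index_iota 0 p) q ^+ k = 0.
  have := subrX1 q p; rewrite qp subrr big_mkord => /esym/eqP.
  by rewrite mulf_eq0 subr_eq0 (negbTE q1) => /eqP.
rewrite scale0r addr0 big_const_nat subn0 iter_addr_0 -[e *+ p]scaler_nat scalerA mulVf ?scale1r //.
by rewrite pnatr_eq0 -lt0n.
Qed.

(** The rows are unit vectors, so each entry has modulus at most [1]. *)
Lemma unitary_bound U : U \is unitarymx -> nrm U <= 1 *+ (n.+1 * n.+1).
Proof.
move=> /unitarymxP/matrixP Uu; apply: nrm_le_bound => i l.
have := Uu i i; rewrite !mxE eqxx => h.
have h1 : \sum_k `|U i k| ^+ 2 = 1.
  by rewrite -[RHS]h; apply: eq_bigr => k _; rewrite !mxE normCK.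
have : `|U i l| ^+ 2 <= 1.
  by rewrite -h1 (bigD1 l) //= lerDl sumr_ge0 // => k _; rewrite exprn_ge0.
by rewrite expr_le1 // -cabsE -lecR.
Qed.

Lemma root_proj_bound U : cabs w = 1 -> U \is unitarymx ->
  nrm (root_proj p w U) <= 1 *+ (n.+1 * n.+1).
Proof.
move=> w1 Uu; have Vb k : nrm ((w *: U) ^+ k) <= 1 *+ (n.+1 * n.+1).
  rewrite exprZn nrmZ (_ : cabs (w ^+ k) = 1) ?mul1r; last first.
    by elim: k => [|k IH]; rewrite ?expr0 ?cabs1 // exprS cabsM IH w1 mulr1.
  apply: unitary_bound; elim: k => [|k IH]; first exact: unitary1.
  by rewrite exprS mulr_unitary.
rewrite nrmZ (_ : cabs _ = p%:R^-1); last first.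
  by rewrite -(rmorph_nat (real_complex R)) -fmorphV cabs_real ger0_norm ?invr_ge0.
rewrite mulrC ler_pdivrMr ?ltr0n // big_mkord; apply: le_trans (nrm_sum _) _.
apply: (@le_trans _ _ (\sum_(k < p) 1 *+ (n.+1 * n.+1))); first by apply: ler_sum.
by rewrite sumr_const card_ord mulr_natr.
Qed.

End RootProj.

End Holonomy.

(** * Loops in a maximal torus *)

Section Circle.
Variable R : realType.

Definition circle (s : R) : Cplx R :=
  Complex (cos (pi *+ 2 * s)) (sin (pi *+ 2 * s)).

Lemma circleD s t : circle (s + t) = circle s * circle t.
Proof. by rewrite /circle mulrDr cosD sinD; apply/eqP; rewrite eq_complex /= eqxx addrC eqxx. Qed.

Lemma circle0 : circle 0 = 1.
Proof. by rewrite /circle mulr0 cos0 sin0. Qed.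

Lemma circle1 : circle 1 = 1.
Proof. by rewrite /circle mulr1 cos2pi sin2pi. Qed.

Lemma circleX s k : circle s ^+ k = circle (s *+ k).
Proof.
elim: k => [|k IH]; first by rewrite expr0 mulr0n circle0.
by rewrite exprS IH -circleD mulrS.
Qed.

Lemma circle_nat k : circle k%:R = 1.
Proof. by rewrite -circleX circle1 expr1n. Qed.

Lemma circleN s : circle (- s) = (circle s)^-1.
Proof.
have h : circle s * circle (- s) = 1 by rewrite -circleD subrr circle0.
have s0 : circle s != 0.
  by apply/eqP => s0; move/eqP: h; rewrite s0 mul0r eq_sym oner_eq0.
by apply: (mulfI s0); rewrite h divff.
Qed.

Lemma cabs_circle s : cabs (circle s) = 1.
Proof. by rewrite /cabs normc_def /= cos2Dsin2 sqrtr1. Qed.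

(** If [cos (2 x) = 1] with [x = pi s], the double angle formula gives [sin x = 0], whereas
    [0 < x < pi]. *)
Lemma circle_neq1 s : 0 < s < 1 -> circle s != 1.
Proof.
move=> /andP[s0 s1]; apply/eqP => -[h _].
have : 0 < sin (pi * s).
  by apply: sin_gt0_pi; rewrite mulr_gt0 ?pi_gt0 //= gtr_pMr ?pi_gt0.
have := cos_mulr2n (pi * s); rewrite -mulrnAl h => e.
have := cos2Dsin2 (pi * s); move=> e2 s2.
have : 0 < sin (pi * s) ^+ 2 by rewrite exprn_gt0.
lra.
Qed.

Lemma circle_continuous s (e : R) : 0 < e ->
  \forall t \near s, cabs (circle t - circle s) <= e.
Proof.
move=> e0; have e2 : 0 < e / 2 by rewrite divr_gt0.
have ac : {for s, continuous ( *%R (pi *+ 2 : R))} by exact: mulrl_continuous.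
have /cvgrPdist_le/(_ _ e2) hc : (cos \o *%R (pi *+ 2 : R)) @ s --> cos (pi *+ 2 * s).
  by apply: continuous_comp => //; apply: continuous_cos.
have /cvgrPdist_le/(_ _ e2) hs : (sin \o *%R (pi *+ 2 : R)) @ s --> sin (pi *+ 2 * s).
  by apply: continuous_comp => //; apply: continuous_sin.
apply: filterS2 hc hs => t /= h1 h2.
rewrite -opprB cabsN; apply: le_trans (cabs_le _) _.
by rewrite !raddfB /=; lra.
Qed.

End Circle.

Section TorusLoop.
Variables (R : realType) (n : nat).
Local Notation M := 'M[Cplx R]_n.+1.
Implicit Types e g : M.

(** For [z = exp (2 pi i s)] this is [z ^ n e + z^-1 (1 - e)], with the eigenvalue on [e] factored
    out as in [root_proj_eigen]. *)
Definition torus_loop e (s : R) : M :=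
  circle (n%:R * s) *: (e + circle (- (n.+1%:R * s)) *: (1 - e)).

Lemma torus_loop0 e : torus_loop e 0 = 1.
Proof. by rewrite /torus_loop !mulr0 oppr0 circle0 !scale1r addrC subrK. Qed.

Lemma torus_loop1 e : torus_loop e 1 = 1.
Proof.
by rewrite /torus_loop !mulr1 circleN !circle_nat invr1 !scale1r addrC subrK.
Qed.

Lemma torus_loopD e : idem e -> {morph torus_loop e : s t / s + t >-> s * t}.
Proof.
move=> ie s t.
have e1 : e * (1 - e) = 0 by rewrite mulrBr mulr1 ie subrr.
have e2 : (1 - e) * e = 0 by rewrite mulrBl mul1r ie subrr.
have e3 : (1 - e) * (1 - e) = 1 - e by rewrite mulrBr mulr1 e2 subr0.
rewrite /torus_loop -scalerAl -scalerAr scalerA mulrDr circleD; congr (_ *: _).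
rewrite mulrDl !mulrDr -!scalerAl -!scalerAr ie e1 e2 e3.
by rewrite !scaler0 addr0 add0r scalerA opprD circleD.
Qed.

Lemma torus_loop_unit e s : idem e -> torus_loop e s \is a GRing.unit.
Proof.
move=> ie; have h t : torus_loop e t * torus_loop e (- t) = 1.
  by rewrite -(torus_loopD ie t (- t)) subrr torus_loop0.
apply/unitrP; exists (torus_loop e (- s)); split; last exact: h.
by have := h (- s); rewrite opprK.
Qed.

Lemma comm_torus_loop e e' s t : GRing.comm e e' ->
  GRing.comm (torus_loop e s) (torus_loop e' t).
Proof.
have cZ (x : Cplx R) (C D : M) : GRing.comm C D -> GRing.comm C (x *: D).
  by move=> CD; rewrite /GRing.comm -scalerAr -scalerAl CD.
have cl (C D : M) r : GRing.comm C D -> GRing.comm C (torus_loop D r).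
  move=> CD; apply: (cZ); apply: commrD => //; apply: (cZ).
  by apply: commrB => //; apply: commr1.
by move=> ee; apply: (cl); apply: commr_sym; apply: (cl); apply: commr_sym.
Qed.

Lemma conj_delta_idem g i : g \is a GRing.unit -> idem (g * delta_mx i i * g^-1).
Proof.
move=> gU; rewrite /idem !mulrA -(mulrA _ g^-1) mulVr // mulr1.
by rewrite -[g * _ * _]mulrA mul_delta eqxx.
Qed.

Lemma conj_delta_orth g i j : g \is a GRing.unit -> i != j ->
  (g * delta_mx i i * g^-1) * (g * delta_mx j j * g^-1) = 0.
Proof.
move=> gU ij; rewrite !mulrA -(mulrA _ g^-1) mulVr // mulr1.
by rewrite -[g * _ * _]mulrA mul_delta (negbTE ij) mulr0 mul0r.
Qed.

(** In the frame [g] the loop is diagonal, with [z ^ n] once and [z^-1] repeated [n] times. *)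
Lemma torus_loop_SL g i s : g \is a GRing.unit ->
  SL R n.+1 (torus_loop (g * delta_mx i i * g^-1) s).
Proof.
move=> gU; rewrite /SL /=; set q := circle (- (n.+1%:R * s)).
pose d : 'rV[Cplx R]_n.+1 := \row_k (if k == i then 1 else q).
have -> : torus_loop (g * delta_mx i i * g^-1) s =
    circle (n%:R * s) *: (g * diag_mx d * g^-1).
  congr (_ *: _); have -> : diag_mx d = delta_mx i i + q *: (1 - delta_mx i i).
    apply/matrixP => a b; rewrite !mxE.
    have [->|ab] := eqVneq a b; last first.
      have -> : (a == i) && (b == i) = false.
        by apply/andP => -[/eqP ai /eqP bi]; move: ab; rewrite ai bi eqxx.
      by rewrite mulr0n subr0 mulr0 addr0.
    by case: eqVneq => _ /=; rewrite ?subrr ?mulr0 ?addr0 ?subr0 ?mulr1 ?add0r.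
  by rewrite mulrDr mulrDl -scalerAr -scalerAl !(mulrBr, mulrBl) mulr1 divrr.
rewrite detZ; have -> : \det (g * diag_mx d * g^-1) = \det (diag_mx d).
  by rewrite -!mulmxE !det_mulmx mulrC mulrA -det_mulmx mulmxE mulVr // det1 mul1r.
rewrite det_diag (bigD1 i) //= mxE eqxx mul1r (eq_bigr (fun=> q)); last first.
  by move=> k ki; rewrite mxE (negbTE ki).
rewrite prodr_const cardC1 card_ord /= /q !circleX -circleD.
rewrite mulNrn -[n%:R * s *+ _]mulr_natl -[n.+1%:R * s *+ _]mulr_natl mulrCA subrr.
exact: circle0.
Qed.

Lemma ncvg_torus_loop e s : ncvg (nbhs s) (torus_loop e) (torus_loop e s).
Proof.
(* The scalar is treated as a scalar matrix so that [ncvgM] applies to it. *)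
have cc r : ncvg (nbhs s) (fun t => circle (r * t) *: (1 : M)) (circle (r * s) *: 1).
  move=> d d0; have d1 : 0 < d / (nrm (1 : M) + 1).
    by rewrite divr_gt0 // ltr_pwDr ?nrm_ge0.
  have hr : r * t @[t --> s] --> r * s by exact: mulrl_continuous.
  have hc : \forall t \near s,
      cabs (circle (r * t) - circle (r * s)) <= d / (nrm (1 : M) + 1).
    exact: hr (circle_continuous (r * s) d1).
  apply: filterS hc => t; rewrite ler_pdivlMr ?ltr_pwDr ?nrm_ge0 // => h.
  rewrite -scalerBl nrmZ; apply: le_trans h.
  by rewrite ler_wpM2l ?cabs_ge0 // lerDl.
have E t : torus_loop e t = (circle (n%:R * t) *: 1) *
    (e + (circle (- n.+1%:R * t) *: 1) * (1 - e)).
  by rewrite -!scalerAl !mul1r mulNr.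
rewrite [X in ncvg _ X _](funext E) E.
apply: ncvgM => //; apply: ncvgD; first exact: ncvg_cst.
by apply: ncvgM => //; apply: ncvg_cst.
Qed.

End TorusLoop.

(** * Uniform subdivision of a two-parameter family *)

Section Mesh.
Variables (R : realType) (n : nat).
Local Notation M := 'M[Cplx R]_n.+1.

(** Near each point of the unit square short increments in [s] are close to [1]; compactness, in its
    near-covering form, makes the step length uniform. *)
Lemma uniform_mesh (A : R * R -> M) : (forall p, A p \is a GRing.unit) ->
  (forall p, ncvg (nbhs p) A (A p)) ->
  exists m, (0 < m)%N /\ forall t s s', t \in `[0, 1] -> s \in `[0, 1] ->
    `|s - s'| <= m%:R^-1 -> near1 (A (t, s') * (A (t, s))^-1).
Proof.
move=> AU Ac.
pose I : set R := `[0, 1]%classic.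
pose P m (p : R * R) := forall s', `|p.2 - s'| <= m.+1%:R^-1 ->
  near1 (A (p.1, s') * (A p)^-1).
have cI : compact (I `*` I) by apply: compact_setX; apply: segment_compact.
have [m _ hm] : \forall m \near \oo, I `*` I `<=` P m; last first.
  exists m.+1; split=> // t s s' tI sI; exact: (hm m (leqnn m) (t, s)).
move/compact_near_coveringP: cI; apply => -[t s] _.
set B := (A (t, s))^-1; pose c := nrm B + 1.
have c0 : 0 < c by rewrite ltr_pwDr // nrm_ge0.
(* Two deviations of at most [1 / (16 c)], times an inverse of norm at most [c], give the radius
   [1/8] of [near1]. *)
have d0 : 0 < (16 * c)^-1 by rewrite invr_gt0 mulr_gt0.
have Vc : ncvg (nbhs (t, s)) (fun p => (A p)^-1) B.
  by apply: ncvgV => //; apply: filterE.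
have : \forall p \near (t, s), nrm (A p - A (t, s)) <= (16 * c)^-1 /\ nrm ((A p)^-1 - B) <= 1.
  by apply: filterS2 (Ac (t, s) _ d0) (Vc 1 ltr01) => p.
move=> [[U V] /= [/nbhs_ballP[r /= r0 rU] /nbhs_ballP[u /= u0 uV]] UV].
have u2 : 0 < u / 2 by rewrite divr_gt0.
(* Half of the radius is kept for the step from [s'] to [s'']. *)
exists (U `*` ball s (u / 2), [set m | m.+1%:R^-1 < u / 2]) => /=.
  split.
    exists (U, ball s (u / 2)) => //=; split; last exact: nbhsx_ballx.
    by apply/nbhs_ballP; exists r.
  by have /posnumP[v] := u2; exact: near_infty_natSinv_lt.
move=> [[t' s'] m] /= [[Ut' sb] mu] s'' hs; rewrite /= in hs.
have [h1 h2] : nrm (A (t', s') - A (t, s)) <= (16 * c)^-1 /\ nrm ((A (t', s'))^-1 - B) <= 1.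
  by apply: (UV (t', s')); split => //; apply: uV; apply: le_ball sb; lra.
have [h3 _] : nrm (A (t', s'') - A (t, s)) <= (16 * c)^-1 /\ nrm ((A (t', s''))^-1 - B) <= 1.
  apply: (UV (t', s'')); split => //; apply: uV; rewrite [u]splitr.
  apply: ball_triangle sb _; exact: le_lt_trans hs mu.
rewrite /near1; have -> : A (t', s'') * (A (t', s'))^-1 - 1 =
    ((A (t', s'') - A (t, s)) - (A (t', s') - A (t, s))) * (A (t', s'))^-1.
  by rewrite opprB addrA subrK mulrBl divrr.
apply: le_trans (nrmM _ _) _.
have h4 := nrmD (A (t', s'') - A (t, s)) (- (A (t', s') - A (t, s))); rewrite nrmN in h4.
have h5 := nrmD ((A (t', s'))^-1 - B) B; rewrite subrK in h5.
have h6 : nrm (A (t', s'))^-1 <= c by rewrite /c; lra.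
have h7 : nrm (A (t', s'') - A (t, s) - (A (t', s') - A (t, s)))
    <= (16 * c)^-1 + (16 * c)^-1 by lra.
have := ler_pM (nrm_ge0 _) (nrm_ge0 _) h7 h6 => /le_trans; apply.
by rewrite invfM -mulrDl -mulrA mulVf ?gt_eqF //; lra.
Qed.

(** Retracting the line onto [[0, 1]] turns the deformation into a family over all real [t], so
    continuity and ranks can be handled on the whole line. *)
Definition clamp (t : R) : R := Num.max 0 (Num.min 1 t).

Lemma clamp_itv t : clamp t \in `[0, 1].
Proof. by rewrite in_itv /= /clamp le_max lexx ge_max ler01 ge_min lexx. Qed.

Lemma clamp_id t : t \in `[0, 1] -> clamp t = t.
Proof.
by rewrite in_itv /= /clamp => /andP[t0 t1]; rewrite (min_idPr t1) (max_idPr t0).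
Qed.

Lemma clamp_continuous : continuous clamp.
Proof.
move=> t; apply: (@continuous_max _ R (fun=> 0)); first exact: cvg_cst.
by apply: (@continuous_min _ R (fun=> 1)); [exact: cvg_cst | exact: cvg_id].
Qed.

End Mesh.

(** * Spectral projections carried along the deformation *)

Section Deformation.
Variables (R : realType) (n : nat).
Local Notation M := 'M[Cplx R]_n.+1.
Implicit Types e g : M.

Variable phi : R -> M -> M.
Hypothesis phi_cont :
  {within `[0, 1]%classic `*` SL R n.+1, continuous (fun p => phi p.1 p.2)}.
Hypothesis phi_SL : forall t A, t \in `[0, 1] -> SL R n.+1 A -> SL R n.+1 (phi t A).
Hypothesis phi_comm : forall t A B, t \in `[0, 1] -> SL R n.+1 A -> SL R n.+1 B ->
  A *m B = B *m A -> phi t A *m phi t B = phi t B *m phi t A.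
Hypothesis phi_ends : forall A, SL R n.+1 A -> phi 0 A = A /\ SU R n.+1 (phi 1 A).

Definition frame_idem e := exists2 gi : M * 'I_n.+1,
  gi.1 \is a GRing.unit & e = gi.1 * delta_mx gi.2 gi.2 * gi.1^-1.

Definition loop_deform e t s := phi (clamp t) (torus_loop e s).

Lemma frame_idem_idem e : frame_idem e -> idem e.
Proof. by move=> [[g i] gU ->]; apply: conj_delta_idem. Qed.

Lemma frame_idem_SL e s : frame_idem e -> SL R n.+1 (torus_loop e s).
Proof. by move=> [[g i] gU ->]; apply: torus_loop_SL. Qed.

Lemma loop_deform_unit e t s : frame_idem e -> loop_deform e t s \is a GRing.unit.
Proof.
move=> eF; have := phi_SL (clamp_itv t) (frame_idem_SL s eF).
move=> h; suff : loop_deform e t s \in unitmx by [].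
by rewrite unitmxE /loop_deform h unitr1.
Qed.

Lemma comm_loop_deform e e' t s s' : frame_idem e -> frame_idem e' -> GRing.comm e e' ->
  GRing.comm (loop_deform e t s) (loop_deform e' t s').
Proof.
move=> eF eF' ee; apply: phi_comm; [exact: clamp_itv | exact: frame_idem_SL |exact: frame_idem_SL|].
exact: comm_torus_loop.
Qed.

(** [phi] is continuous within its domain only, but [h] maps every pair into that domain, so the
    restriction disappears after composition. *)
Lemma ncvg_loop_deform e p : frame_idem e ->
  ncvg (nbhs p) (fun q => loop_deform e q.1 q.2) (loop_deform e p.1 p.2).
Proof.
move=> eF; pose D : set (R * M) := `[0, 1]%classic `*` SL R n.+1.
pose h q := (clamp q.1, torus_loop e q.2) : (R * M)%type.
have hD q : D (h q) by split; [exact: clamp_itv | exact: frame_idem_SL].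
have hc : h @ nbhs p --> h p.
  have h1 : clamp q.1 @[q --> p] --> clamp p.1.
    exact: (cvg_comp fst _ (cvg_fst (F := nbhs p.1) (G := nbhs p.2)) (@clamp_continuous R p.1)).
  have h2 : torus_loop e q.2 @[q --> p] --> torus_loop e p.2.
    exact: (cvg_comp snd _ (cvg_snd (F := nbhs p.1) (G := nbhs p.2))
      (ncvg_cvg (ncvg_torus_loop e p.2))).
  exact: cvg_pair h1 h2.
move/subspace_continuousP: phi_cont => /(_ _ (hD p)) /cvg_ncvg pc d d0.
have W : nbhs (h p) [set y : R * M | D y ->
    nrm (phi y.1 y.2 - phi (h p).1 (h p).2) <= d] by exact: pc d d0.
have W' : \forall q \near p, D (h q) ->
    nrm (phi (h q).1 (h q).2 - phi (h p).1 (h p).2) <= d by exact: hc W.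
by apply: filterS W' => q /(_ (hD q)).
Qed.

Definition fine_mesh e : set nat := fun m => (0 < m)%N /\
  forall t s s', t \in `[0, 1] -> s \in `[0, 1] -> `|s - s'| <= m%:R^-1 ->
    near1 (loop_deform e t s' * (loop_deform e t s)^-1).

(* The mesh is chosen as a function of [e] alone, so that [proj_deform] does not
   depend on the frame to which [e] belongs. *)
Definition mesh e := xget 1%N (fine_mesh e).

Lemma meshP e : frame_idem e -> fine_mesh e (mesh e).
Proof.
move=> eF; apply: xgetPex.
exact: uniform_mesh (fun p => loop_deform_unit p.1 p.2 eF)
  (fun p => ncvg_loop_deform p eF).
Qed.

Lemma mesh_gt0 e : frame_idem e -> (0 < mesh e)%N.
Proof. by move=> /meshP[]. Qed.

Lemma mesh_increment e t k : frame_idem e -> (k < mesh e)%N ->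
  near1 (increment (mesh e) (loop_deform e t) k).
Proof.
move=> /meshP[m0 hm] km; have mR : 0 < (mesh e)%:R :> R by rewrite ltr0n.
have hk : (k%:R / (mesh e)%:R : R) \in `[0, 1].
  by rewrite in_itv /= divr_ge0 // ler_pdivrMr // mul1r ler_nat ltnW.
have := hm (clamp t) _ (k.+1%:R / (mesh e)%:R) (clamp_itv t) hk.
rewrite /increment /loop_deform (clamp_id (clamp_itv t)); apply.
by rewrite -natr1 mulrDl mul1r opprD addrA subrr sub0r normrN ger0_norm // invr_ge0.
Qed.

Lemma loop_deform0 e : frame_idem e -> loop_deform e 0 = torus_loop e.
Proof.
move=> eF; apply: funext => s; rewrite /loop_deform clamp_id; last by rewrite in_itv /= lexx ler01.
by have [] := phi_ends (frame_idem_SL s eF).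
Qed.

Lemma mesh_near1 e s : frame_idem e -> 0 <= s <= (mesh e)%:R^-1 -> near1 (torus_loop e s).
Proof.
move=> eF /andP[s0 s1]; have [_ hm] := meshP eF.
have h0 : (0 : R) \in `[0, 1] by rewrite in_itv /= lexx ler01.
have := hm 0 0 s h0 h0; rewrite (loop_deform0 eF) torus_loop0 invr1 mulr1; apply.
by rewrite sub0r normrN ger0_norm.
Qed.

(** [root] is the inverse of the eigenvalue of [torus_loop e (2^-1 ^+ n.+1)] on [e]. As
    [n + 1 < 2 ^ (n + 1)], the eigenvalue on [1 - e] is different. *)
Local Notation order := (2 ^ n.+1)%N.
Local Notation root := (circle (- (n%:R * 2^-1 ^+ n.+1)) : Cplx R).

(* At [t = 0] this is [e]; its rank is locally constant in [t], and at [t = 1] it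
   is a polynomial with bounded coefficients in a unitary matrix. *)
Definition proj_deform e t : M :=
  root_proj order root (holonomy n.+1 (mesh e) (loop_deform e t)).

(** Used with [k = n] for [root], and with [k = n + 1] for the ratio of the two eigenvalues. *)
Lemma circle_root_exp k : circle (- (k%:R * 2^-1 ^+ n.+1)) ^+ order = 1 :> Cplx R.
Proof.
rewrite circleX mulNrn circleN -[_ * _ *+ _]mulr_natr natrX -mulrA -exprMn.
by rewrite mulVf ?pnatr_eq0 // expr1n mulr1 circle_nat invr1.
Qed.



(** The deformed loop is closed because both of its ends are the image of [1] under
    [phi (clamp t)]. *)
Lemma holonomy_deform_exp e t : frame_idem e ->
  holonomy n.+1 (mesh e) (loop_deform e t) ^+ order = 1.
Proof.
move=> eF; apply: (holonomy_exp _ (fun k => @mesh_increment e t k eF) (mesh_gt0 eF)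
  (fun s => loop_deform_unit t s eF)).
  by move=> s s'; apply: comm_loop_deform.
by rewrite /loop_deform torus_loop0 torus_loop1.
Qed.

Lemma proj_deform_idem e t : frame_idem e -> idem (proj_deform e t).
Proof.
by move=> eF; apply: root_proj_idem; rewrite ?expn_gt0 ?circle_root_exp ?holonomy_deform_exp.
Qed.

(** Commutation passes from the loops to the roots of their increments, to the holonomies, and to
    polynomials in these. *)
Lemma comm_proj_deform e e' t : frame_idem e -> frame_idem e' -> GRing.comm e e' ->
  GRing.comm (proj_deform e t) (proj_deform e' t).
Proof.
move=> eF eF' ee.
apply: comm_root_proj; apply/commr_sym; apply: comm_root_proj; apply/commr_sym.
apply: (comm_holonomy _ (fun k => @mesh_increment e' t k eF')) => s; apply/commr_sym.
apply: (comm_holonomy _ (fun k => @mesh_increment e t k eF)) => s'.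
by apply/commr_sym; apply: comm_loop_deform.
Qed.

Lemma ncvg_proj_deform e t : frame_idem e -> ncvg (nbhs t) (proj_deform e) (proj_deform e t).
Proof.
move=> eF; apply: ncvg_root_proj.
apply: (ncvg_holonomy _ (fun t k => @mesh_increment e t k eF)
  (fun t' s => loop_deform_unit t' s eF)) => s.
have hp : (fun t' => (t', s)) @ nbhs t --> (t, s).
  exact: (cvg_pair (f := id) (g := fun=> s) (H := nbhs s) cvg_id (cvg_cst s)).
exact: (ncvg_comp hp (ncvg_loop_deform (t, s) eF)).
Qed.

Lemma proj_deform0 e : frame_idem e -> proj_deform e 0 = e.
Proof.
move=> eF; have ie := frame_idem_idem eF.
rewrite /proj_deform (loop_deform0 eF) (holonomy_1psg _ (mesh_gt0 eF) (torus_loopD ie)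
  (fun s => torus_loop_unit s ie) (fun s => mesh_near1 eF)).
have rV : root^-1 = circle (n%:R * 2^-1 ^+ n.+1) by rewrite circleN invrK.
have := @root_proj_eigen R n order root _ (circle_root_exp n) e
  (circle (- (n.+1%:R * 2^-1 ^+ n.+1))) ie.
rewrite expn_gt0 rV => /(_ isT); apply.
- exact: circle_root_exp.
rewrite circleN invr_eq1; apply: circle_neq1.
rewrite mulr_gt0 ?ltr0n ?exprn_gt0 ?invr_gt0 //= exprVn ltr_pdivrMr ?exprn_gt0 //.
by rewrite mul1r -natrX ltr_nat ltn_expl.
Qed.

Lemma proj_deform1_bound e : frame_idem e -> nrm (proj_deform e 1) <= 1 *+ (n.+1 * n.+1).
Proof.
move=> eF; apply: root_proj_bound (cabs_circle _) _; first by rewrite expn_gt0.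
apply: (holonomy_unitary _ (fun k => @mesh_increment e 1 k eF)) => s.
rewrite /loop_deform clamp_id; last by rewrite in_itv /= lexx ler01.
by have [_ []] := phi_ends (frame_idem_SL s eF).
Qed.


(** The product of two commuting idempotents is idempotent, so its rank is constant in [t], and it
    is [0] at [t = 0]. *)
Lemma proj_deform_orth e e' t : frame_idem e -> frame_idem e' ->
  e * e' = 0 -> e' * e = 0 -> proj_deform e t * proj_deform e' t = 0.
Proof.
move=> eF eF' ee' e'e; pose f s := proj_deform e s * proj_deform e' s.
have c s : GRing.comm (proj_deform e s) (proj_deform e' s).
  by apply: comm_proj_deform => //; rewrite /GRing.comm ee' e'e.
have fi s : idem (f s).
  exact: idemM (c s) (proj_deform_idem s eF) (proj_deform_idem s eF').
have fc s : ncvg (nbhs s) f (f s).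
  exact: ncvgM (ncvg_proj_deform s eF) (ncvg_proj_deform s eF').
have f0 : f 0 = 0 by rewrite /f (proj_deform0 eF) (proj_deform0 eF').
apply/eqP; rewrite -mxrank_eq0; apply/eqP.
by apply: etrans (idem_rank_const t fi fc) _; rewrite f0 mxrank0.
Qed.

(** By orthogonality the sum is an idempotent for every [t]; it keeps the full rank that it has at
    [t = 0], and an invertible idempotent is [1]. *)
Lemma sum_proj_deform g : g \is a GRing.unit ->
  \sum_i proj_deform (g * delta_mx i i * g^-1) 1 = 1.
Proof.
move=> gU; pose E i := g * delta_mx i i * g^-1; pose S t := \sum_i proj_deform (E i) t.
have EF i : frame_idem (E i) by exists (g, i).
have Si t : idem (S t).
  apply: idem_sum => [i|i k ik]; first exact: proj_deform_idem (EF i).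
  apply: (proj_deform_orth t (EF i) (EF k) (conj_delta_orth gU ik)).
  by apply: conj_delta_orth gU _; rewrite eq_sym.
have Sc t : ncvg (nbhs t) S (S t).
  by apply: ncvg_sum => i; apply: ncvg_proj_deform (EF i).
have S0 : S 0 = 1.
  rewrite /S (eq_bigr E) => [|i _]; last exact: proj_deform0 (EF i).
  by rewrite -mulr_suml -mulr_sumr sum_delta_mx mulr1 divrr.
have := idem_rank_const 1 Si Sc; rewrite S0 mxrank1 => S1.
have S1U : S 1 \in unitmx by rewrite -row_free_unit /row_free S1.
by apply: (mulrI S1U); rewrite mulr1; exact: Si.
Qed.

(** The frame function is the projection at [t = 1]. It sees a frame only through the idempotent
    [g * delta_mx i i * g^-1], which yields [P_conj]. *)
Lemma no_unitary_deformation : (2 <= n)%N -> False.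
Proof.
apply: (@no_bounded_frame_function R n (fun g i => proj_deform (g * delta_mx i i * g^-1) 1)
  (1 *+ (n.+1 * n.+1))).
- exact: sum_proj_deform.
- by move=> g i gU; apply: proj_deform1_bound; exists (g, i).
- move=> i k ik; have F l : frame_idem (1 * delta_mx l l * 1^-1).
    by exists (1, l) => //; apply: unitr1.
  apply: (proj_deform_orth 1 (F i) (F k) (conj_delta_orth (unitr1 _) ik)).
  by apply: conj_delta_orth (unitr1 _) _; rewrite eq_sym.
move=> g u i k gU uU e; congr (proj_deform _ 1).
by rewrite invrM // mulrA -(mulrA g) e !mulrA mulrK.
Qed.

End Deformation.

Theorem theorem1p1 (R : realType) (n : nat) (hn : (8 <= n)%N) :
  ~ exists phi : R -> 'M[Cplx R]_n -> 'M[Cplx R]_n,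
      [/\ {within `[0, 1]%classic `*` SL R n, continuous (fun p => phi p.1 p.2)},
          forall t A, t \in `[0, 1] -> SL R n A -> SL R n (phi t A),
          forall t A B, t \in `[0, 1] -> SL R n A -> SL R n B ->
            A *m B = B *m A -> phi t A *m phi t B = phi t B *m phi t A
        & forall A, SL R n A -> phi 0 A = A /\ SU R n (phi 1 A)].
Proof.
(* The ring structure on square matrices asks for the size in successor form. *)
case: n hn => // n hn [phi [phi_cont phi_SL phi_comm phi_ends]].
apply: (no_unitary_deformation phi_cont phi_SL phi_comm phi_ends).
by rewrite -ltnS (leq_trans _ hn).
Qed.
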